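(* Let $W$ be a step-graphon whose skeleton graph (for some partition) is connected. Suppose that for some partition $\sigma$ of $W$, with concentration vector $x^*$ and skeleton graph $S$, the following two conditions hold: (A) $S$ has an odd cycle; (B) $x^*$ belongs to the relative interior of the edge polytope $\mathcal{X}(S)$. Then $W$ has the $H$-property, i.e., $\lim_{n\to\infty}\mathbb{P}(\vec G_n \text{ has a Hamiltonian decomposition})=1$ for $G_n\sim W$.
   Context: A graphon is a symmetric measurable function $W:[0,1]^2\to[0,1]$. $W$ is a step-graphon if there is an increasing sequence $0=\sigma_0<\sigma_1<\dots<\sigma_q=1$ (a partition for $W$) such that $W$ is constant on each rectangle $[\sigma_{i},\sigma_{i+1})\times[\sigma_j,\sigma_{j+1})$. The concentration vector is $x^*=(x^*_1,\dots,x^*_q)$ with $x^*_i=\sigma_i-\sigma_{i-1}$. The skeleton graph $S=(U,F)$ of $W$ for $\sigma$ is the undirected graph (possibly with self-loops, no multiple edges) on $U=\{u_1,\dots,u_q\}$ with an edge (or self-loop if $i=j$) $(u_i,u_j)\in F$ iff $W$ is nonzero on $[\sigma_{i-1},\sigma_i)\times[\sigma_{j-1},\sigma_j)$. A cycle is odd if it has an odd number of distinct nodes; self-loops count as odd cycles. The incidence matrix $Z_S=[z_{ij}]$ is the $q\times|F|$ matrix with $z_{ij}=1$ if $f_j$ is a self-loop at $u_i$, $z_{ij}=1/2$ if $f_j$ is a non-loop edge incident to $u_i$, and $0$ otherwise; its columns $z_j$ are probability vectors. The edge polytope is $\mathcal{X}(S)=\operatorname{conv}\{z_j: 1\le j\le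 |F|\}$; relative interior is taken in its affine hull. Sampling $G_n\sim W$: draw $y_1,\dots,y_n$ i.i.d. uniform on $[0,1]$ (coordinates of nodes $v_1,\dots,v_n$), and for each pair of distinct nodes $v_i,v_j$ independently place an undirected edge with probability $W(y_i,y_j)$. For an undirected graph $G$, $\vec G$ is the digraph obtained by replacing each edge $(v_i,v_j)$ by the two directed edges $v_iv_j$ and $v_jv_i$. A Hamiltonian decomposition of a digraph is a spanning subgraph that is a node-disjoint union of directed cycles (2-cycles $v_iv_jv_i$ allowed) covering all nodes. *)

(* Defs.v *)
From HB Require Import structures.
From mathcomp Require Import all_boot all_order all_algebra.
From mathcomp Require Import all_classical all_reals all_analysis.
Set Implicit Arguments. Unset Strict Implicit. Unset Printing Implicit Defensive.
Import Order.TTheory GRing.Theory Num.Theory.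
Import numFieldNormedType.Exports.
Local Open Scope classical_set_scope.
Local Open Scope ring_scope.

Section Graphons.
Variable R : realType.

(* A graphon: symmetric measurable W : [0,1]^2 -> [0,1] (W is given on R x R,
   only its values on [0,1]^2 matter). *)
Definition graphon (W : R -> R -> R) : Prop :=
  measurable_fun ((`[0, 1] : set (measurableTypeR R)) `*` (`[0, 1] : set (measurableTypeR R)))
    (fun p : measurableTypeR R * measurableTypeR R => W p.1 p.2) /\
  (forall x y, x \in `[0, 1] -> y \in `[0, 1] -> 0 <= W x y <= 1) /\
  (forall x y, x \in `[0, 1] -> y \in `[0, 1] -> W x y = W y x).

Definition block (sigma : nat -> R) (i : nat) : set R :=
  [set x | sigma i <= x /\ x < sigma i.+1].

Definition is_partition (W : R -> R -> R) (q : nat) (sigma : nat -> R) : Prop :=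
  sigma 0%N = 0 /\ sigma q = 1 /\ (forall i, (i < q)%N -> sigma i < sigma i.+1) /\
  (forall i j : 'I_q, forall x x' y y',
      block sigma i x -> block sigma i x' -> block sigma j y -> block sigma j y' ->
      W x y = W x' y').

Definition step_graphon (W : R -> R -> R) : Prop :=
  graphon W /\ exists q sigma, is_partition W q sigma.

Definition skeleton (W : R -> R -> R) (q : nat) (sigma : nat -> R) : rel 'I_q :=
  fun i j => `[< exists x y, block sigma i x /\ block sigma j y /\ W x y != 0 >].

Definition graph_connected (q : nat) (S : rel 'I_q) : Prop :=
  forall i j : 'I_q, connect S i j.

(* An odd cycle: a cycle with an odd number of distinct nodes; a cycle with one
   node is a self-loop. *)
Definition has_odd_cycle (q : nat) (S : rel 'I_q) : Prop :=
  exists c : seq 'I_q, [&& uniq c, odd (size c) & cycle S c].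

Definition concentration (q : nat) (sigma : nat -> R) : 'I_q -> R :=
  fun i => sigma i.+1 - sigma i.

Definition edge_index (q : nat) (S : rel 'I_q) : pred ('I_q * 'I_q) :=
  fun p => ((p.1 <= p.2)%N && S p.1 p.2).

(* Column z_f of the incidence matrix Z_S: 1 at a loop, 1/2 at both ends. *)
Definition incidence_col (q : nat) (p : 'I_q * 'I_q) : 'I_q -> R :=
  fun k => ((k == p.1)%:R + (k == p.2)%:R) / 2.

Definition in_edge_polytope (q : nat) (S : rel 'I_q) (x : 'I_q -> R) : Prop :=
  exists lam : 'I_q * 'I_q -> R,
    (forall p, edge_index S p -> 0 <= lam p) /\
    \sum_(p | edge_index S p) lam p = 1 /\
    (forall k, x k = \sum_(p | edge_index S p) lam p * incidence_col p k).

Definition in_edge_affine_hull (q : nat) (S : rel 'I_q) (x : 'I_q -> R) : Prop :=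
  exists lam : 'I_q * 'I_q -> R,
    \sum_(p | edge_index S p) lam p = 1 /\
    (forall k, x k = \sum_(p | edge_index S p) lam p * incidence_col p k).

Definition in_relint_edge_polytope (q : nat) (S : rel 'I_q) (x : 'I_q -> R) : Prop :=
  in_edge_polytope S x /\
  exists2 eps : R, 0 < eps &
    forall y : 'I_q -> R, in_edge_affine_hull S y ->
      (forall k, `|y k - x k| < eps) -> in_edge_polytope S y.

(* Undirected loopless graph on 'I_n encoded by its edge set E of pairs (i,j), i<j. *)
Definition upper_pairs (n : nat) : {set 'I_n * 'I_n} :=
  [set p : 'I_n * 'I_n | (p.1 < p.2)%N].

Definition adjE (n : nat) (E : {set 'I_n * 'I_n}) : rel 'I_n :=
  fun i j => ((i, j) \in E) || ((j, i) \in E).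

(* The digraph vec G has arcs i->j and j->i for each edge {i,j} of G, i.e. its
   arc relation is adjE E.  A Hamiltonian decomposition: a family of
   node-disjoint directed cycles (length >= 2) of vec G covering all nodes. *)
Definition has_ham_decomposition (n : nat) (adj : rel 'I_n) : Prop :=
  exists cs : seq (seq 'I_n),
    (forall c, c \in cs -> [&& uniq c, (2 <= size c)%N & cycle adj c]) /\
    uniq (flatten cs) /\ (forall v : 'I_n, v \in flatten cs).

(* Probability of the graph E given node coordinates y (y i for node i). *)
Definition edge_weight (W : R -> R -> R) (n : nat) (y : nat -> R)
    (E : {set 'I_n * 'I_n}) : R :=
  \prod_(p : 'I_n * 'I_n | (p.1 < p.2)%N)
     (if p \in E then W (y p.1) (y p.2) else 1 - W (y p.1) (y p.2)).

(* Expectation over n i.i.d. uniform [0,1] coordinates y_0,...,y_{n-1},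
   as an iterated Lebesgue integral. *)
Fixpoint iter_unif_int (k : nat) (f : (nat -> R) -> \bar R) : \bar R :=
  match k with
  | 0%N => f (fun _ => 0)
  | k'.+1 => (\int[@lebesgue_measure R]_(t in (`[0%R, 1%R] : set R))
               iter_unif_int k' (fun y => f (fun i => if i == k' then t else y i)))%E
  end.

Definition ham_prob (W : R -> R -> R) (n : nat) : \bar R :=
  iter_unif_int n (fun y =>
    (\sum_(E : {set 'I_n * 'I_n} | E \subset upper_pairs n)
       edge_weight W y E * (`[< has_ham_decomposition (adjE E) >] : bool)%:R)%:E).

Definition H_property (W : R -> R -> R) : Prop :=
  ham_prob W n @[n --> \oo] --> 1%E.

End Graphons.

Arguments skeleton {R} W q sigma.
Arguments concentration {R} q sigma.

(* Main.v *)
Require Import Defs.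
From HB Require Import structures.
From mathcomp Require Import all_boot all_order all_algebra.
From mathcomp Require Import all_classical all_reals all_analysis.
From mathcomp Require Import measurable_realfun lra ring zify.

(**
  A Hamiltonian decomposition of the digraph of G is a permutation f of the
  nodes with v adjacent to f v, that is, a perfect matching of the bipartite
  double cover of G.  By Hall's theorem it fails to exist only if there are sets
  X, Y of nodes with |X| + |Y| > n and no edge between X and Y.  Since x^* is in
  the relative interior of the edge polytope, every edge of S can be given a
  positive coefficient in a representation of x^*; as S is connected and not
  bipartite, this yields g > 0 with x^*(A) + g <= x^*(N(A)) for every proper
  nonempty set A of blocks.  With high probability the block sizes are within
  delta n of n x^* (Chebyshev), every node has degree at least eta n (Chernoff),
  and any two sets of at least delta n nodes in adjacent blocks are joined by an
  edge (union bound over 4^n pairs of sets).  Let A and B be the sets of blocks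
  in which X, respectively Y, has at least delta n nodes: B misses N(A), and the
  gap g contradicts |X| + |Y| > n unless A is empty or full, in which case X or
  Y is smaller than the degree of any node. *)

Set Implicit Arguments. Unset Strict Implicit. Unset Printing Implicit Defensive.
Import Order.TTheory GRing.Theory Num.Theory.
Import numFieldNormedType.Exports.
Local Open Scope ring_scope.

(** * Hall's theorem and Hamiltonian decompositions *)

(** Rado's argument, by induction on the total size of the sets: from a set with two elements one of
    them can be deleted without breaking Hall's condition, and once all sets are singletons the
    condition makes them distinct. *)
Lemma hall_marriage (I T : finType) (F : I -> {set T}) :
  (forall J : {set I}, (#|J| <= #|\bigcup_(i in J) F i|)%N) ->
  exists2 f : I -> T, injective f & forall i, f i \in F i.
Proof.
move: {2}(\sum_i #|F i|)%N.+1 (ltnSn (\sum_i #|F i|)%N) => m.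
elim: m F => // m IH F ltm hall.
have hsub (G G' : I -> {set T}) (J : {set I}) : (forall i, i \in J -> G i \subset G' i) ->
    \bigcup_(i in J) G i \subset \bigcup_(i in J) G' i.
  move=> GG'; apply/fintype.subsetP => t /bigcupP[i iJ tG].
  by apply/bigcupP; exists i => //; apply: (fintype.subsetP (GG' i iJ)).
pose rem v x := fun i => if i == v then F i :\ x else F i.
have rem_lt v x : x \in F v -> (\sum_i #|rem v x i| < \sum_i #|F i|)%N.
  move=> xv; rewrite (bigD1 v) //= [X in (_ < X)%N](bigD1 v) //= /rem eqxx.
  rewrite (cardsD1 x (F v)) xv add1n addSn ltnS leq_add2l.
  by apply: leq_sum => i /negPf ->.
case: (pickP [pred v | (1 < #|F v|)%N]) => [v /= /card_gt1P[x [y [xv yv xy]]]|small].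
  (* Either deleting [z] from [F v] preserves Hall's condition and the induction applies, or some
     family violates it; that family contains [v], since only [F v] has changed. *)
  have try z : z \in F v ->
     (exists2 f : I -> T, injective f & forall i, f i \in F i) \/
     exists2 J : {set I}, v \in J & (#|\bigcup_(i in J) rem v z i| < #|J|)%N.
    move=> zv.
    case: (pickP [pred J : {set I} | (#|\bigcup_(i in J) rem v z i| < #|J|)%N]) => [J /= ltJ|hallz].
      right; exists J => //; apply: contraLR ltJ => vJ; rewrite -leqNgt.
      apply: leq_trans (hall J) _; apply: subset_leq_card; apply: hsub => i iJ.
      by rewrite /rem; case: eqP vJ => // <-; rewrite iJ.
    left; case: (IH (rem v z)) => [||f fI fP].
    - exact: leq_trans (rem_lt _ _ zv) _.
    - by move=> J; rewrite leqNgt; apply/negP => h; have := hallz J; rewrite /= h.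
    exists f => // i; have := fP i; rewrite /rem; case: ifP => // _.
    by rewrite !inE => /andP[].
  case: (try x xv) => // -[J1 v1 lt1]; case: (try y yv) => // -[J2 v2 lt2].
  exfalso; set P := \bigcup_(i in J1) _ in lt1; set Q := \bigcup_(i in J2) _ in lt2.
  have PUQ : \bigcup_(i in J1 :|: J2) F i \subset P :|: Q.
    apply/fintype.subsetP => t /bigcupP[i]; rewrite inE => iJ tF.
    have [iv|niv] := eqVneq i v.
      rewrite inE; have [tx|tx] := eqVneq t x; apply/orP; [right|left]; apply/bigcupP; exists v => //.
        by rewrite /rem eqxx !inE tx xy.
      by rewrite /rem eqxx !inE tx -iv.
    rewrite inE; case/orP: iJ => iJ; apply/orP; [left|right]; apply/bigcupP; exists i => //;
    by rewrite /rem (negPf niv).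
  have PIQ : \bigcup_(i in (J1 :&: J2) :\ v) F i \subset P :&: Q.
    apply/fintype.subsetP => t /bigcupP[i]; rewrite !inE => /and3P[niv i1 i2] tF.
    by apply/andP; split; apply/bigcupP; exists i => //; rewrite /rem (negPf niv).
  (* Hall's condition makes |P| + |Q| at least |J1| + |J2| - 1, whereas [lt1] and [lt2] make it at
     most |J1| + |J2| - 2. *)
  have := leq_trans (hall _) (subset_leq_card PUQ).
  have := leq_trans (hall _) (subset_leq_card PIQ).
  have := cardsUI P Q; have := cardsUI J1 J2.
  have := cardsD1 v (J1 :&: J2); rewrite inE v1 v2 /=.
  lia.
have F1 i : exists t, F i = [set t].
  apply/cards1P; have := small i => /= /negbT; rewrite -leqNgt => le1.
  have := hall [set i]; rewrite cards1 big_set1 => ge1.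
  by rewrite eqn_leq le1 ge1.
have [f fP] := boolp.choice F1.
exists f => [i j eij|i]; last by rewrite fP set11.
apply/eqP/negPn/negP => nij.
have := hall [set i; j]; rewrite cards2 nij (finset.bigcup_setU) !big_set1 !fP eij finset.setUid.
by rewrite cards1.
Qed.

Lemma uniq_flatten_disjoint (A T : eqType) (F : A -> seq T) (s : seq A) :
  uniq s -> (forall a, uniq (F a)) ->
  {in s &, forall a b t, t \in F a -> t \in F b -> a = b} ->
  uniq (flatten [seq F a | a <- s]).
Proof.
move=> us uF; elim: s us => //= a s IH /andP[nas us] dis.
rewrite cat_uniq uF IH // ?andbT /=; last first.
  by move=> b c bs cs; apply: dis; rewrite inE ?bs ?cs orbT.
apply/hasPn => t /flatten_mapP[b bs tb]; apply/negP => ta.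
by case/negP: nas; rewrite (dis a b _ _ t) ?inE ?eqxx ?bs ?orbT.
Qed.

(** The orbits of [f] are the cycles; irreflexivity of [adj] rules out fixed points, so each has
    length at least 2. *)
Lemma ham_decomposition_of_injection (n : nat) (adj : rel 'I_n) (f : 'I_n -> 'I_n) :
  irreflexive adj -> injective f -> (forall v, adj v (f v)) ->
  has_ham_decomposition adj.
Proof.
move=> irr fI fadj.
have sym := fconnect_sym fI.
exists [seq orbit f x | x <- enum (roots (frel f))]; split; [|split].
- move=> c /mapP[x _ ->]; apply/and3P; split.
  + exact: orbit_uniq.
  + rewrite size_orbit ltnNge; apply/negP => o1.
    have : order f x = 1%N by apply/eqP; rewrite eqn_leq o1 order_gt0.
    move=> o; have := iter_order fI x; rewrite o /= => fx.
    by have := fadj x; rewrite fx irr.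
  + by apply: sub_cycle (cycle_orbit fI x) => u v /eqP <-.
- apply: uniq_flatten_disjoint; [exact: enum_uniq|exact: orbit_uniq|].
  move=> a b; rewrite !mem_enum => /eqP ra /eqP rb t.
  rewrite -!fconnect_orbit => at_ bt.
  rewrite -ra -rb; apply/(fingraph.rootP sym).
  by apply: (connect_trans at_); rewrite sym.
- move=> v; apply/flatten_mapP; exists (fingraph.root (frel f) v).
    by rewrite mem_enum; apply: roots_root.
  by rewrite -fconnect_orbit sym connect_root.
Qed.

(* Hall's condition in the bipartite double cover: a failing set X gives the pair (X, ~: N X). *)
Lemma no_ham_decomposition (n : nat) (adj : rel 'I_n) :
  irreflexive adj -> ~ has_ham_decomposition adj ->
  exists X Y : {set 'I_n}, (n < #|X| + #|Y|)%N /\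
    (forall x y, x \in X -> y \in Y -> ~~ adj x y).
Proof.
move=> irr noham.
pose N x := [set y | adj x y].
case: (pickP [pred X : {set 'I_n} | (#|\bigcup_(x in X) N x| < #|X|)%N]) => [X /= ltX|hall].
  exists X, (~: \bigcup_(x in X) N x); split.
    by rewrite -{1}(card_ord n) -(cardsC (\bigcup_(x in X) N x)) ltn_add2r.
  move=> x y xX; rewrite inE; apply: contra => xy; apply/bigcupP; exists x => //.
  by rewrite inE.
exfalso; apply: noham.
have [|f fI fP] := @hall_marriage _ _ N.
  by move=> J; rewrite leqNgt; apply/negP => h; have := hall J; rewrite /= h.
by apply: (ham_decomposition_of_injection irr fI) => v; have := fP v; rewrite inE.
Qed.

(** * Expansion of the skeleton graph *)

Lemma connect_stable (T : finType) (e : rel T) (P : pred T) x y :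
  (forall u v, e u v -> P u -> P v) -> connect e x y -> P x -> P y.
Proof.
move=> stab /connectP[s + ->]; elim: s x => //= z s IH x /andP[xz zs] Px.
exact: IH zs (stab _ _ xz Px).
Qed.

Definition nbhd (T : finType) (e : rel T) (A : {set T}) : {set T} :=
  [set j | [exists i in A, e i j]].

Lemma nbhdP (T : finType) (e : rel T) (A : {set T}) j :
  reflect (exists2 i, i \in A & e i j) (j \in nbhd e A).
Proof. by rewrite inE; apply: (iffP exists_inP) => -[i]; exists i. Qed.

(* Walking once around an odd cycle exchanges A and its neighbourhood, so
   their intersection is nonempty and closed under adjacency. *)
Lemma two_step_closed_full (q : nat) (S : rel 'I_q) (A : {set 'I_q}) :
  symmetric S -> graph_connected S -> has_odd_cycle S ->
  A != finset.set0 -> nbhd S (nbhd S A) \subset A ->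
  A = [set: 'I_q]%SET /\ nbhd S A = [set: 'I_q]%SET.
Proof.
move=> symS conS [[|c p] /and3P[_ oddc cyc] //] /set0Pn[a aA] /fintype.subsetP NNA.
set B := nbhd S A in NNA *.
have AB u v : S u v -> u \in A -> v \in B by move=> uv uA; apply/nbhdP; exists u.
have BA u v : S u v -> u \in B -> v \in A by move=> uv uB; apply: NNA; apply/nbhdP; exists u.
have walk s x : path S x s ->
    (x \in A -> last x s \in if odd (size s) then B else A) /\
    (x \in B -> last x s \in if odd (size s) then A else B).
  elim: s x => //= y s IH x /andP[xy /IH[IA IB]]; split=> [/(AB _ _ xy) /IB|/(BA _ _ xy) /IA];
  by case: (odd (size s)).
have [cA cB] : (c \in A -> c \in B) /\ (c \in B -> c \in A).
  by have := walk _ _ cyc; rewrite last_rcons size_rcons; move: oddc => /= ->.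
have cAB : (c \in A) || (c \in B).
  apply: (connect_stable (P := [pred v | (v \in A) || (v \in B)]) _ (conS a c)); last by rewrite /= aA.
  by move=> u v uv /= /orP[/(AB _ _ uv) ->|/(BA _ _ uv) ->]; rewrite ?orbT.
have all v : (v \in A) && (v \in B).
  apply: (connect_stable (P := [pred v | (v \in A) && (v \in B)]) _ (conS c v)).
    by move=> u w uw /= /andP[/(AB _ _ uw) -> /(BA _ _ uw) ->].
  by case/orP: cAB => /= h; [rewrite h cA|rewrite h cB].
by split; apply/finset.setP => v; rewrite finset.in_setT; case/andP: (all v).
Qed.

(** Turns finitely many strict inequalities into one uniform constant; the default 1 of the minimum
    covers an empty range. *)
Lemma finite_positive_lower_bound (R : realFieldType) (I : finType) (P : pred I) (F : I -> R) :
  (forall i, P i -> 0 < F i) -> exists2 g, 0 < g & forall i, P i -> g <= F i.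
Proof.
move=> F0; exists (\big[Num.min/1]_(i | P i) F i).
  by apply: (big_ind (fun g => 0 < g)) => // a b a0 b0; rewrite lt_min a0.
by move=> i Pi; apply: bigmin_le_cond.
Qed.

Section EdgePolytope.
Variable R : realType.

(** Move x slightly away from the column z of [f], to y = x + t (x - z). This y is still in the
    polytope, and x = (y + t z) / (1 + t) gives [f] a coefficient of at least t / (1 + t). *)
Lemma relint_edge_coefficient_pos (q : nat) (S : rel 'I_q) (x : 'I_q -> R) (f : 'I_q * 'I_q) :
  in_relint_edge_polytope S x -> edge_index S f ->
  exists lam : 'I_q * 'I_q -> R,
    [/\ forall p, edge_index S p -> 0 <= lam p, 0 < lam f &
     forall k, x k = \sum_(p | edge_index S p) lam p * incidence_col R p k].
Proof.
move=> [[lam [lam0 [lam1 xE]]] [eps eps0 near_x]] Sf.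
pose z := incidence_col R f.
(* [M] exceeds every |x k - z k|, so t = eps / M changes each coordinate by less than [eps]. *)
pose M := 1 + \sum_k `|x k - z k|.
have M0 : 0 < M by rewrite ltr_pwDl // sumr_ge0.
have [t t0 tE] : exists2 t, 0 < t & t = eps / M by exists (eps / M); rewrite ?divr_gt0.
have sumf G : \sum_(p | edge_index S p) (p == f)%:R * G p = G f :> R.
  rewrite (bigD1 f) //= eqxx mul1r big1 ?addr0 // => p /andP[_ /negPf ->].
  by rewrite mul0r.
have [||mu [mu0 [mu1 yE]]] := near_x (fun k => x k + t * (x k - z k)).
- exists (fun p => (1 + t) * lam p - t * (p == f)%:R); split.
    rewrite big_split /= -mulr_sumr lam1 sumrN -mulr_sumr.
    under [X in t * X]eq_bigr do rewrite -[(_ == _)%:R]mulr1.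
    by rewrite (sumf (fun=> 1)) !mulr1 addrK.
  move=> k; rewrite [in LHS]xE.
  under [RHS]eq_bigr do rewrite mulrBl -!mulrA.
  rewrite big_split /= -mulr_sumr sumrN -mulr_sumr; rewrite (sumf (fun p => incidence_col R p k)) /z; ring.
- move=> k; rewrite addrC addKr normrM (gtr0_norm t0) tE.
  rewrite mulrAC ltr_pdivrMr // ltr_pM2l // /M (bigD1 k) //=.
  by rewrite addrCA ltrDl ltr_pwDl // sumr_ge0.
exists (fun p => (1 + t)^-1 * (mu p + t * (p == f)%:R)).
have t1 : 0 < 1 + t by lra.
split=> [p Sp||k].
- by rewrite mulr_ge0 ?invr_ge0 ?(ltW t1) // addr_ge0 ?mu0 // mulr_ge0 ?(ltW t0).
- by rewrite mulr_gt0 ?invr_gt0 // eqxx mulr1 ltr_wpDl ?mu0.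
under eq_bigr do rewrite -mulrA mulrDl -mulrA.
rewrite -mulr_sumr big_split /= -mulr_sumr (sumf (fun p => incidence_col R p k)) -yE /z.
by field; lra.
Qed.

(** In the mass of [A], an edge is weighted by half the number of its ends in [A], a loop counting
    as two ends. *)
Lemma sum_incidence (q : nat) (P : pred ('I_q * 'I_q)) (lam : 'I_q * 'I_q -> R) (x : 'I_q -> R)
    (A : {set 'I_q}) :
  (forall k, x k = \sum_(p | P p) lam p * incidence_col R p k) ->
  \sum_(k in A) x k = \sum_(p | P p) lam p * (((p.1 \in A)%:R + (p.2 \in A)%:R) / 2).
Proof.
move=> xE; under eq_bigr do rewrite xE.
rewrite exchange_big /=; apply: eq_bigr => p _; rewrite -mulr_sumr; congr (_ * _).
have one (i : 'I_q) : \sum_(k in A) (k == i)%:R = (i \in A)%:R :> R.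
  case: (boolP (i \in A)) => iA.
    by rewrite (bigD1 i) //= eqxx big1 ?addr0 // => k /andP[_ /negPf ->].
  by rewrite big1 // => k kA; case: eqP kA => // ->; rewrite (negPf iA).
by rewrite -mulr_suml big_split /= !one.
Qed.

(** Every edge has at least as many ends in the neighbourhood of [A] as in [A]. A proper nonempty
    [A] is not closed under two steps, so some edge leads from the neighbourhood to a block outside
    [A]; there the inequality is strict, and that edge can be given a positive coefficient. *)
Lemma relint_expansion (q : nat) (S : rel 'I_q) (x : 'I_q -> R) :
  symmetric S -> graph_connected S -> has_odd_cycle S -> in_relint_edge_polytope S x ->
  exists2 g, 0 < g & forall A : {set 'I_q}, A != finset.set0 -> A != [set: 'I_q]%SET ->
    \sum_(i in A) x i + g <= \sum_(i in nbhd S A) x i.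
Proof.
move=> symS conS oddS xri.
have [A /andP[An0 AnT]|g g0 gP] := @finite_positive_lower_bound R _
  [pred A : {set 'I_q} | (A != finset.set0) && (A != [set: 'I_q]%SET)]
  (fun A => \sum_(i in nbhd S A) x i - \sum_(i in A) x i); last first.
  by exists g => // A An0 AnT; rewrite addrC -lerBrDr; apply: gP; rewrite /= An0.
have /subsetPn[k /nbhdP[l lN Slk] kA] : ~~ (nbhd S (nbhd S A) \subset A).
  by apply: contra AnT => /(two_step_closed_full symS conS oddS An0)[-> _].
pose f := if (k <= l)%N then (k, l) else (l, k).
have Sf : edge_index S f.
  rewrite /f /edge_index; case: (leqP k l) => [kl|lk] /=; first by rewrite kl symS.
  by rewrite ltnW.
have [lam [lam0 lamf xE]] := relint_edge_coefficient_pos xri Sf.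
rewrite !(sum_incidence _ xE) -sumrB (bigD1 f) //=.
have inN u v : S u v -> (u \in A)%:R <= (v \in nbhd S A)%:R :> R.
  by case: (boolP (u \in A)) => // uA Suv; have -> : v \in nbhd S A by apply/nbhdP; exists u.
rewrite ltr_pwDl //; last first.
  apply: sumr_ge0 => p /andP[Sp _]; rewrite -mulrBr mulr_ge0 ?lam0 //.
  case/andP: Sp => _ Sp; have := inN _ _ Sp; rewrite symS in Sp; have := inN _ _ Sp.
  lra.
rewrite -mulrBr mulr_gt0 //.
have : (k \in A)%:R + (l \in A)%:R < (k \in nbhd S A)%:R + (l \in nbhd S A)%:R :> R.
  by rewrite lN (negPf kA) [ltRHS]addrC ltr_leD ?ltr01 ?inN.
rewrite /f; case: (leqP k l) => _ /=; lra.
Qed.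

End EdgePolytope.

(** * Obstructions to a Hamiltonian decomposition *)

(** The deterministic half of the argument: both alternatives are unlikely in a random graph. The
    bound on [2 * q%:R * delta] absorbs an error of at most [delta * n%:R] per block in each of two
    sets. *)
Lemma no_ham_certificate (R : realType) (q n : nat) (S : rel 'I_q) (x : 'I_q -> R) (g eta delta : R)
    (b : 'I_n -> 'I_q) (adj : rel 'I_n) :
  (forall c, 0 <= x c) -> \sum_c x c = 1 ->
  (forall A : {set 'I_q}, A != finset.set0 -> A != [set: 'I_q]%SET ->
    \sum_(i in A) x i + g <= \sum_(i in nbhd S A) x i) ->
  nbhd S [set: 'I_q]%SET = [set: 'I_q]%SET ->
  0 <= delta -> 2 * q%:R * delta <= g -> q%:R * delta <= eta ->
  (forall c, #|[set v | b v == c]|%:R <= n%:R * (x c + delta)) ->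
  irreflexive adj -> symmetric adj -> ~ has_ham_decomposition adj ->
  (exists v, #|[set u | adj v u]|%:R < eta * n%:R) \/
  exists (c d : 'I_q) (X Y : {set 'I_n}),
    [/\ S c d, X \subset [set v | b v == c], Y \subset [set v | b v == d],
        (delta * n%:R <= #|X|%:R) && (delta * n%:R <= #|Y|%:R) &
        forall u v, u \in X -> v \in Y -> ~~ adj u v].
Proof.
move=> x0 x1 expand nbhdT delta0 deltag deltaeta counts irr symadj noham.
apply: contrapT => /not_orP[/forallNP deg /forallNP noempty].
have {}deg v : eta * n%:R <= #|[set u | adj v u]|%:R.
  by rewrite leNgt; apply/negP; apply: deg.
have [X [Y [ltXY noXY]]] := no_ham_decomposition irr noham.
pose V (c : 'I_q) : {set 'I_n} := [set v | b v == c]%SET.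
pose big (Z : {set 'I_n}) : {set 'I_q} := [set c | delta * n%:R <= #|Z :&: V c|%:R].
have n0 : 0 <= n%:R :> R by [].
(* A block in [big Z] contributes at most its whole size, any other block less than
   [delta * n%:R]. *)
have leZ (Z : {set 'I_n}) : #|Z|%:R <= n%:R * (\sum_(c in big Z) x c + q%:R * delta).
  have -> : #|Z| = (\sum_c #|Z :&: V c|)%N.
    rewrite -sum1_card (partition_big b xpredT) //=; apply: eq_bigr => c _.
    by rewrite -sum1_card; apply: eq_bigl => v; rewrite !inE.
  have -> : q%:R * delta = \sum_(c < q) delta by rewrite sumr_const card_ord mulr_natl.
  rewrite [X in X + _]big_mkcond -big_split mulr_sumr natr_sum /=; apply: ler_sum => c _.
  rewrite inE; case: ifP => [_|/negbT]; last by rewrite -ltNge add0r mulrC => /ltW.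
  by apply: le_trans (counts c); rewrite ler_nat subset_leq_card // finset.subsetIr.
have notSAB c d : c \in big X -> d \in big Y -> ~~ S c d.
  rewrite !inE => Xc Yd; apply/negP => Scd; apply: (noempty c).
  exists d, (X :&: V c), (Y :&: V d); split=> //; [exact: finset.subsetIr|exact: finset.subsetIr|by rewrite Xc|].
  by move=> u v; rewrite !inE => /andP[uX _] /andP[vY _]; apply: noXY.
have misses v (Z : {set 'I_n}) : (forall u, u \in Z -> ~~ adj v u) -> #|Z|%:R <= n%:R - eta * n%:R.
  move=> vZ; rewrite lerBrDr; apply: le_trans (_ : #|Z|%:R + #|[set u | adj v u]|%:R <= _).
    by rewrite lerD2l.
  rewrite -natrD ler_nat -cardsUI -[X in (_ <= X)%N]addn0; apply: leq_add.
    by rewrite -[X in (_ <= X)%N]card_ord max_card.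
  rewrite leqn0 cards_eq0; apply/eqP/finset.setP => u; rewrite !inE.
  by case: (boolP (u \in Z)) => // /vZ /negPf.
have nXY : n%:R < #|X|%:R + #|Y|%:R :> R by rewrite -natrD ltr_nat.
have deltan : q%:R * delta * n%:R <= eta * n%:R by rewrite ler_wpM2r.
have nonempty (Z Z' : {set 'I_n}) : (n < #|Z| + #|Z'|)%N -> exists z, z \in Z.
  move=> lt; apply/set0Pn; rewrite -cards_eq0; apply: contraL lt => /eqP ->.
  by rewrite add0n -leqNgt -[X in (_ <= X)%N]card_ord max_card.
have := leZ X; have := leZ Y.
(* Here |X| is at most [eta * n%:R], while [Y] avoids the neighbours of a vertex of [X]; so |X| +
   |Y| is at most n. *)
have [A0|An0] := eqVneq (big X) finset.set0.
  have [u uX] := nonempty X Y ltXY.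
  have := misses u Y (fun v => noXY u v uX).
  by rewrite A0 big_set0; nra.
(* Every block has a neighbour, so no block can be in [big Y], and the previous case recurs with [X]
   and [Y] exchanged. *)
have [AT|AnT] := eqVneq (big X) [set: 'I_q]%SET.
  have -> : big Y = finset.set0.
    apply/finset.setP => d; rewrite finset.in_set0; apply/negP => dY.
    have : d \in nbhd S [set: 'I_q]%SET by rewrite nbhdT finset.in_setT.
    case/nbhdP => c _ Scd; have := notSAB c d; rewrite AT Scd finset.in_setT.
    by move=> /(_ isT dY).
  have [v vY] : exists v, v \in Y by apply: (nonempty Y X); rewrite addnC.
  have : #|X|%:R <= n%:R - eta * n%:R by apply: (misses v) => u uX; rewrite symadj noXY.
  by rewrite big_set0; nra.
have := expand _ An0 AnT.
(* [big Y] avoids the neighbourhood of [big X]. With the expansion this bounds |X| + |Y| by n (1 - g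
   + 2 q delta), hence by n. *)
have : \sum_(d in big Y) x d <= 1 - \sum_(c in nbhd S (big X)) x c.
  rewrite -x1 lerBrDr [leRHS](bigID (mem (nbhd S (big X)))) /= [leLHS]addrC lerD2l.
  rewrite [leLHS]big_mkcond [leRHS]big_mkcond; apply: ler_sum => d _.
  case: (boolP (d \in big Y)) => dY; last by case: ifP.
  rewrite ifT //; apply/nbhdP => -[c cX Scd].
  by have := notSAB c d cX dY; rewrite Scd.
nra.
Qed.

(** * Random graphs with given edge probabilities *)

Section EdgeProbability.
Variables (R : realType) (n : nat).
Implicit Types (E : {set 'I_n * 'I_n}) (X Y : {set 'I_n}).

(** The left side is the expectation of the product of [g] over the edges; it factorizes because the
    pairs are independent. *)
Lemma edge_generating_function (h g : 'I_n * 'I_n -> R) :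
  \sum_(E : {set 'I_n * 'I_n} | E \subset upper_pairs n)
     (\prod_(p : 'I_n * 'I_n | (p.1 < p.2)%N) (if p \in E then h p else 1 - h p)) *
     (\prod_(p : 'I_n * 'I_n | (p.1 < p.2)%N) (if p \in E then g p else 1))
  = \prod_(p : 'I_n * 'I_n | (p.1 < p.2)%N) (h p * g p + (1 - h p)).
Proof.
(* The values 0 and 1 off the upper pairs kill every subset that is not a set of upper pairs. *)
pose F (p : 'I_n * 'I_n) := if (p.1 < p.2)%N then h p * g p else 0.
pose G (p : 'I_n * 'I_n) := if (p.1 < p.2)%N then 1 - h p else 1.
transitivity (\prod_p (F p + G p)); last first.
  rewrite [RHS]big_mkcond; apply: eq_bigr => p _; rewrite /F /G.
  by case: ifP => // _; rewrite add0r.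
rewrite bigA_distr big_mkcond; apply: eq_bigr => E _.
case: (boolP (E \subset upper_pairs n)) => [/fintype.subsetP sE|/subsetPn[p pE pU]]; last first.
  by rewrite (bigD1 p) //= pE /F; move: pU; rewrite inE => /negPf ->; rewrite mul0r.
rewrite -big_split /= big_mkcond; apply: eq_bigr => p _; rewrite /F /G.
case: ifP => [lt|nlt]; first by case: ifP; rewrite ?mulr1.
by case: ifP => // /sE; rewrite inE nlt.
Qed.

(** An edge is stored in increasing order, so either end may be the one in [X]. *)
Definition joins X Y (p : 'I_n * 'I_n) :=
  (p.1 \in X) && (p.2 \in Y) || (p.2 \in X) && (p.1 \in Y).

(* Each unordered pair arises from at most two ordered ones, whence the 1/2. *)
Lemma sum_joins_ge (H : 'I_n -> 'I_n -> R) X Y (c : R) :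
  (forall u v, 0 <= H u v) -> (forall u v, H u v = H v u) -> 0 <= c ->
  (forall u v, u \in X -> v \in Y -> c <= H u v) ->
  c * (#|X|%:R * (#|Y|%:R - 1)) / 2 <=
  \sum_(p : 'I_n * 'I_n | (p.1 < p.2)%N) (joins X Y p)%:R * H p.1 p.2.
Proof.
move=> H0 symH c0 cH; rewrite ler_pdivrMr // mulrC.
pose K (p : 'I_n * 'I_n) := ((p.1 \in X) && (p.2 \in Y))%:R * H p.1 p.2.
apply: (@le_trans _ _ (\sum_(p | p.1 != p.2) K p)).
  have -> : \sum_(p | p.1 != p.2) K p = \sum_u \sum_(v | u != v) K (u, v).
    by rewrite pair_big_dep.
  have -> : #|X|%:R * (#|Y|%:R - 1) * c = \sum_(u in X) (#|Y|%:R - 1) * c.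
    by rewrite sumr_const -[RHS]mulr_natl mulrA.
  rewrite big_mkcond; apply: ler_sum => u _; case: ifP => uX; last first.
    by apply: sumr_ge0 => v _; rewrite /K /= mulr_ge0.
  (* The loss of 1 in |Y| - 1 accounts for [u] itself possibly lying in [Y]. *)
  apply: (@le_trans _ _ (\sum_(v in Y :\ u) c)).
    rewrite sumr_const -[leRHS]mulr_natl ler_wpM2r // lerBlDr natr1 ler_nat.
    by rewrite (cardsD1 u Y) -add1n leq_add2r; case: (u \in Y).
  rewrite big_mkcond [leRHS]big_mkcond; apply: ler_sum => v _.
  rewrite !inE /K /= uX /= eq_sym; case: ifP => [/andP[vu vY]|_].
    by rewrite vu vY mul1r cH.
  by case: ifP => // _; rewrite mulr_ge0.
rewrite (bigID (fun p : 'I_n * 'I_n => (p.1 < p.2)%N)) /= mulr_natr mulr2n.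
apply: lerD.
  rewrite (eq_bigl (fun p : 'I_n * 'I_n => (p.1 < p.2)%N)); last first.
    by move=> p /=; case: ltnP; rewrite ?andbF // andbT => lt; rewrite -val_eqE neq_ltn lt.
  apply: ler_sum => p _; rewrite /K ler_wpM2r // ler_nat /joins.
  by case: ((p.1 \in X) && (p.2 \in Y)).
have swapI : injective (fun p : 'I_n * 'I_n => (p.2, p.1)) by move=> [a a'] [b b'] /= [-> ->].
rewrite (reindex_inj swapI) /=.
rewrite (eq_bigl (fun p : 'I_n * 'I_n => (p.1 < p.2)%N)); last first.
  by move=> p /=; rewrite -leqNgt -val_eqE ltn_neqAle eq_sym.
apply: ler_sum => p _; rewrite /K /= symH ler_wpM2r // ler_nat /joins.
by case: ((p.2 \in X) && (p.1 \in Y)); rewrite ?orbT.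
Qed.

(** The expectation of s to the number of edges joining [X] and [Y], estimated by 1 + t <= exp t in
    each factor. Later s = 1/2 serves for Chernoff's bound and s = 0 for the probability of no
    edge. *)
Lemma edge_generating_function_le (H : 'I_n -> 'I_n -> R) X Y (c s : R) :
  (forall u v, 0 <= H u v <= 1) -> (forall u v, H u v = H v u) -> 0 <= c -> 0 <= s <= 1 ->
  (forall u v, u \in X -> v \in Y -> c <= H u v) ->
  \sum_(E : {set 'I_n * 'I_n} | E \subset upper_pairs n)
     (\prod_(p : 'I_n * 'I_n | (p.1 < p.2)%N) (if p \in E then H p.1 p.2 else 1 - H p.1 p.2)) *
     (\prod_(p : 'I_n * 'I_n | (p.1 < p.2)%N) (if p \in E then if joins X Y p then s else 1 else 1))
  <= expR (- ((1 - s) * (c * (#|X|%:R * (#|Y|%:R - 1)) / 2))).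
Proof.
move=> H01 symH c0 /andP[s0 s1] cH.
rewrite (edge_generating_function (fun p => H p.1 p.2)).
have H0 u v : 0 <= H u v by case/andP: (H01 u v).
apply: le_trans (_ : expR (- ((1 - s) *
   \sum_(p : 'I_n * 'I_n | (p.1 < p.2)%N) (joins X Y p)%:R * H p.1 p.2)) <= _); last first.
  by rewrite ler_expR lerN2 ler_wpM2l ?subr_ge0 // sum_joins_ge.
rewrite mulr_sumr -sumrN expR_sum; apply: ler_prod => p _.
have /andP[h0 h1] := H01 p.1 p.2.
apply/andP; split; first by case: ifP => _; nra.
apply: le_trans (expR_ge1Dx _).
by case: ifP => _ /=; lra.
Qed.

Lemma joins1_card_le E (v : 'I_n) Y : E \subset upper_pairs n ->
  (#|[set p in E | joins [set v]%SET Y p]| <= #|[set u | adjE E v u]|)%N.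
Proof.
move=> /fintype.subsetP sE.
(* [o] sends an edge at [v] to its other end, and is injective on such edges. *)
pose o (p : 'I_n * 'I_n) := if p.1 == v then p.2 else p.1.
rewrite -(@card_in_imset _ _ o); last first.
  move=> [a b] [a' b']; rewrite !inE /joins /o /= !inE.
  move=> /andP[/sE]; rewrite inE /= => lt1 j1 /andP[/sE]; rewrite inE /= => lt2 j2.
  move: lt1 j1 lt2 j2.
  have [->|na] := eqVneq a v; have [->|na'] := eqVneq a' v => /=.
  - by move=> _ _ _ _ ->.
  - by move=> lt1 _ lt2 /andP[/eqP b'v _] e; move: lt2; rewrite b'v -e ltnNge ltnW.
  - by move=> lt1 /andP[/eqP bv _] lt2 _ e; move: lt1; rewrite bv e ltnNge ltnW.
  - by move=> _ /andP[/eqP -> _] _ /andP[/eqP -> _] ->.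
apply/subset_leq_card/fintype.subsetP => u /imsetP[[a b]]; rewrite !inE /joins /o /= !inE /adjE.
have [->|na] := eqVneq a v; first by move=> /andP[vb _] ->; rewrite vb.
by move=> /andP[ab /andP[/eqP <- _]] ->; rewrite ab orbT.
Qed.

End EdgeProbability.

(** A union bound, with the blocks of the vertices fixed, over the two alternatives of
    [no_ham_certificate]: the first error term is for low degrees, the second for pairs of large
    sets without an edge. *)
Lemma prob_ham_ge (R : realType) (q n : nat) (S : rel 'I_q) (x : 'I_q -> R)
    (g eta delta kappa c : R) (b : 'I_n -> 'I_q) (H : 'I_n -> 'I_n -> R) :
  (forall i, 0 <= x i) -> \sum_i x i = 1 ->
  (forall A : {set 'I_q}, A != finset.set0 -> A != [set: 'I_q]%SET ->
    \sum_(i in A) x i + g <= \sum_(i in nbhd S A) x i) ->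
  nbhd S [set: 'I_q]%SET = [set: 'I_q]%SET -> symmetric S ->
  0 <= delta -> 2 * q%:R * delta <= g -> q%:R * delta <= eta -> 1 <= delta * n%:R -> 0 <= c ->
  (forall u v, 0 <= H u v <= 1) -> (forall u v, H u v = H v u) ->
  (forall u v, S (b u) (b v) -> c <= H u v) ->
  (forall i, #|[set v | b v == i]|%:R <= n%:R * (x i + delta)) ->
  (forall i, kappa * n%:R <= #|[set v | b v == i]|%:R) ->
  1 - \sum_(E : {set 'I_n * 'I_n} | E \subset upper_pairs n)
     (\prod_(p : 'I_n * 'I_n | (p.1 < p.2)%N) (if p \in E then H p.1 p.2 else 1 - H p.1 p.2)) *
     (`[< has_ham_decomposition (adjE E) >] : bool)%:R
  <= n%:R * expR (eta * n%:R - c * (kappa * n%:R - 1) / 4)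
     + 4 ^+ n * expR (- (c * (delta * n%:R * (delta * n%:R - 1)) / 2)).
Proof.
move=> x0 x1 expand nbhdT symS delta0 deltag deltaeta dn1 c0 H01 symH cH counts_le counts_ge.
pose V (i : 'I_q) : {set 'I_n} := [set v | b v == i]%SET.
pose wt (E : {set 'I_n * 'I_n}) :=
  \prod_(p : 'I_n * 'I_n | (p.1 < p.2)%N) (if p \in E then H p.1 p.2 else 1 - H p.1 p.2).
pose gf X Y (s : R) (E : {set 'I_n * 'I_n}) :=
  \prod_(p : 'I_n * 'I_n | (p.1 < p.2)%N) (if p \in E then if joins X Y p then s else 1 else 1).
have wt0 E : 0 <= wt E.
  by apply: prodr_ge0 => p _; have /andP[] := H01 p.1 p.2; case: ifP => _; lra.
have wt1 : \sum_(E : {set 'I_n * 'I_n} | E \subset upper_pairs n) wt E = 1.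
  have := edge_generating_function (fun p : 'I_n * 'I_n => H p.1 p.2) (fun=> 1).
  rewrite [RHS]big1 => [|p _]; last by rewrite mulr1 addrC subrK.
  by move=> <-; apply: eq_bigr => E _; rewrite [X in _ * X]big1 ?mulr1 // => p _; case: ifP.
have gf0 X Y (s : R) E : 0 <= s -> 0 <= gf X Y s E.
  by move=> s0; apply: prodr_ge0 => p _; case: ifP => // _; case: ifP.
have nbr v : exists d, S (b v) d.
  have : b v \in nbhd S [set: 'I_q]%SET by rewrite nbhdT finset.in_setT.
  by case/nbhdP => d _; rewrite symS; exists d.
have [d dP] := boolp.choice nbr.
pose T (XY : {set 'I_n} * {set 'I_n}) := [exists i, [exists j,
  [&& S i j, XY.1 \subset V i, XY.2 \subset V j,
      delta * n%:R <= #|XY.1|%:R & delta * n%:R <= #|XY.2|%:R]]].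
(* The indicator of failure is dominated by generating functions: a low degree makes exp(eta n)
   2^(-degree) at least 1, and for s = 0 the product is 1 when no edge joins the two sets. Only the
   edges from [v] to one adjacent block [d v] are counted. *)
have pointwise (E : {set 'I_n * 'I_n}) : E \subset upper_pairs n ->
    1 - (`[< has_ham_decomposition (adjE E) >] : bool)%:R <=
    \sum_v expR (eta * n%:R) * gf [set v]%SET (V (d v)) 2^-1 E +
    \sum_(XY | T XY) gf XY.1 XY.2 0 E.
  move=> EU.
  have S1_0 : 0 <= \sum_v expR (eta * n%:R) * gf [set v]%SET (V (d v)) 2^-1 E.
    by apply: sumr_ge0 => v _; rewrite mulr_ge0 ?expR_ge0 ?gf0.
  have S2_0 : 0 <= \sum_(XY | T XY) gf XY.1 XY.2 0 E.
    by apply: sumr_ge0 => v _; rewrite gf0.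
  case: asboolP => [_|noham]; first by rewrite subrr addr_ge0.
  rewrite subr0.
  have irr : irreflexive (adjE E).
    by move=> v; rewrite /adjE orbb; apply/negP => /(fintype.subsetP EU); rewrite inE /= ltnn.
  have symE : symmetric (adjE E) by move=> u v; rewrite /adjE orbC.
  have [[v degv]|[i [j [X [Y [Sij XV YV /andP[Xn Yn] noXY]]]]]] :=
    no_ham_certificate x0 x1 expand nbhdT delta0 deltag deltaeta counts_le irr symE noham.
    rewrite (bigD1 v) //= -addrA ler_wpDr //.
      rewrite addr_ge0 // sumr_ge0 // => u _.
      by rewrite mulr_ge0 ?expR_ge0 ?gf0.
    have -> : gf [set v]%SET (V (d v)) 2^-1 E =
        2^-1 ^+ #|[set p in E | joins [set v]%SET (V (d v)) p]|.
      rewrite /gf -prodr_const big_mkcond [RHS]big_mkcond; apply: eq_bigr => p _.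
      rewrite !inE; case: (boolP (p \in E)) => [/(fintype.subsetP EU)|] /=; last by case: ifP.
      by rewrite inE => ->.
    have half1 : 2^-1 <= 1 :> R by lra.
    apply: le_trans (_ : expR (eta * n%:R) * 2^-1 ^+ #|[set u | adjE E v u]| <= _); last first.
      by rewrite ler_wpM2l ?expR_ge0 // ler_wiXn2l ?joins1_card_le.
    rewrite exprVn ler_pdivlMr ?exprn_gt0 // mul1r.
    apply: le_trans (_ : expR 1 ^+ #|[set u | adjE E v u]| <= _).
      by rewrite lerXn2r ?nnegrE ?expR_ge0 //; have := @expR_ge1Dx R 1; lra.
    by rewrite -expRM_natl mulr1 ler_expR ltW.
  rewrite (bigD1 (X, Y)) /=; last first.
    by apply/existsP; exists i; apply/existsP; exists j; rewrite Sij XV YV Xn Yn.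
  have -> : gf X Y 0 E = 1.
    rewrite /gf big1 // => -[u v] _; case: ifP => // uvE; rewrite /joins /=.
    case: (boolP (u \in X)) => uX; case: (boolP (v \in Y)) => vY /=.
    - by have := noXY u v uX vY; rewrite /adjE uvE.
    - case: (boolP (v \in X)) => vX //=; case: (boolP (u \in Y)) => uY //=.
      by have := noXY v u vX uY; rewrite /adjE uvE orbT.
    - case: (boolP (v \in X)) => vX //=; case: (boolP (u \in Y)) => uY //=.
      by have := noXY v u vX uY; rewrite /adjE uvE orbT.
    - case: (boolP (v \in X)) => vX //=; case: (boolP (u \in Y)) => uY //=.
      by have := noXY v u vX uY; rewrite /adjE uvE orbT.
  rewrite addrCA lerDl addr_ge0 //; apply: sumr_ge0 => XY _; exact: gf0.
rewrite -[X in X - _ <= _]wt1 -sumrB.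
rewrite (eq_bigr (fun E : {set 'I_n * 'I_n} => wt E *
    (1 - (`[< has_ham_decomposition (adjE E) >] : bool)%:R))); last first.
  by move=> E _; rewrite mulrBr mulr1.
apply: le_trans (ler_sum _ (fun E EU => ler_wpM2l (wt0 E) (pointwise E EU))) _.
under eq_bigr do rewrite mulrDr !mulr_sumr.
rewrite big_split /= exchange_big [X in _ + X <= _]exchange_big /=.
apply: lerD.
  have -> : n%:R * expR (eta * n%:R - c * (kappa * n%:R - 1) / 4) =
    \sum_(v < n) expR (eta * n%:R - c * (kappa * n%:R - 1) / 4).
    by rewrite sumr_const card_ord mulr_natl.
  apply: ler_sum => v _; under eq_bigr do rewrite mulrCA.
  rewrite -mulr_sumr expRD ler_wpM2l ?expR_ge0 //.
  apply: le_trans (edge_generating_function_le H01 symH c0 _ _) _; first by lra.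
    by move=> u w; rewrite !inE => /eqP -> /eqP bw; apply: cH; rewrite bw.
  (* The denominator 4 is 1 - s = 1/2 times the 1/2 of [sum_joins_ge]. *)
  rewrite ler_expR cards1 mul1r lerN2.
  have := counts_ge (d v); rewrite -/(V (d v)); nra.
have -> : 4 ^+ n * expR (- (c * (delta * n%:R * (delta * n%:R - 1)) / 2)) =
  \sum_(XY : {set 'I_n} * {set 'I_n}) expR (- (c * (delta * n%:R * (delta * n%:R - 1)) / 2)).
  rewrite sumr_const card_prod -cardsT -powersetT card_powerset cardsT card_ord -expnMn.
  by rewrite -[RHS]mulr_natl natrX.
rewrite [leLHS]big_mkcond; apply: ler_sum => -[X Y] _; case: ifP => [|_]; last exact: expR_ge0.
move=> /existsP[i /existsP[j /and5P[Sij /fintype.subsetP XV /fintype.subsetP YV /= Xn Yn]]].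
apply: le_trans (edge_generating_function_le H01 symH c0 _ _) _; first by lra.
  by move=> u v /XV; rewrite inE => /eqP bu /YV; rewrite inE => /eqP bv; apply: cH; rewrite bu bv.
rewrite ler_expR lerN2 subr0 mul1r ler_pM2r // ler_wpM2l // ler_pM //; lra.
Qed.

(** * Sampling the coordinates *)

Section StepExpectation.
Variables (R : realType) (q : nat).
Implicit Types (x : 'I_q -> R) (F G : (nat -> 'I_q) -> R).

(* The recursion of iter_unif_int, with the coordinates replaced by the indices
   of the blocks that contain them. *)
Fixpoint disc_exp x (c0 : 'I_q) (k : nat) F : R :=
  match k with
  | 0%N => F (fun=> c0)
  | k'.+1 => \sum_c x c * disc_exp x c0 k' (fun b => F (fun i => if i == k' then c else b i))
  end.

Variables (x : 'I_q -> R) (c0 : 'I_q).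
Hypotheses (x_ge0 : forall c, 0 <= x c) (sum_x : \sum_c x c = 1).
Local Notation EE := (disc_exp x c0).

Lemma disc_exp_le k F G : (forall b, F b <= G b) -> EE k F <= EE k G.
Proof.
elim: k F G => [|k IH] F G FG /=; first exact: FG.
by apply: ler_sum => c _; rewrite ler_wpM2l // IH.
Qed.

Lemma disc_exp_cst k a : EE k (fun=> a) = a.
Proof.
by elim: k => //= k IH; under eq_bigr do rewrite IH; rewrite -mulr_suml sum_x mul1r.
Qed.

Lemma disc_expD k F G : EE k (fun b => F b + G b) = EE k F + EE k G.
Proof.
elim: k F G => //= k IH F G; under eq_bigr do rewrite IH mulrDr.
by rewrite big_split.
Qed.

Lemma disc_exp_sum k (I : finType) (a : I -> R) (F : I -> (nat -> 'I_q) -> R) :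
  EE k (fun b => \sum_i a i * F i b) = \sum_i a i * EE k (F i).
Proof.
elim: k F => //= k IH F; under eq_bigr do rewrite IH mulr_sumr.
rewrite exchange_big; apply: eq_bigr => i _; rewrite mulr_sumr.
by apply: eq_bigr => c _; rewrite mulrCA.
Qed.

(** The variance of a binomial count, by induction: the deviation of the new coordinate has mean
    zero, so the cross term vanishes. *)
Lemma disc_exp_sqr_dev k (c : 'I_q) :
  EE k (fun b => (\sum_(i < k) ((b i == c)%:R - x c)) ^+ 2) = k%:R * (x c * (1 - x c)).
Proof.
elim: k => [|k IH] /=; first by rewrite big_ord0 expr0n mul0r.
rewrite -disc_exp_sum -natr1 mulrDl mul1r -IH -[X in _ + X](disc_exp_cst k) -disc_expD.
congr (disc_exp _ _ _ _); apply/funext => b.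
set D := \sum_(i < k) _.
have devE d : \sum_(i < k.+1) (((if i == k :> nat then d else b i) == c)%:R - x c) =
    D + ((d == c)%:R - x c).
  rewrite big_ord_recr /= eqxx; congr (_ + _); apply: eq_bigr => i _.
  by rewrite ltn_eqF.
under eq_bigr do rewrite devE.
have xone : \sum_d x d * (d == c)%:R = x c.
  by rewrite (bigD1 c) //= eqxx mulr1 big1 ?addr0 // => d /negPf ->; rewrite mulr0.
(* An indicator equals its square, so the square is affine in the indicator and its mean needs only
   [sum_x] and [xone]. *)
under eq_bigr => d _.
  have -> : x d * (D + ((d == c)%:R - x c)) ^+ 2 =
      (D ^+ 2 + x c ^+ 2 - 2 * D * x c) * x d + (1 + 2 * D - 2 * x c) * (x d * (d == c)%:R).
    by case: (d == c); rewrite ?mulr1n ?mulr0n; ring.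
  over.
rewrite big_split /= -!mulr_sumr sum_x xone; ring.
Qed.

End StepExpectation.

(** * Integrals of step functions *)

Section StepIntegral.
Local Open Scope classical_set_scope.
Local Open Scope ring_scope.
Variable R : realType.
Local Notation mu := (@lebesgue_measure R).

Lemma block_itv (sigma : nat -> R) i : block sigma i = `[sigma i, sigma i.+1[%classic.
Proof. by apply/seteqP; split => t; rewrite /block /= in_itv /= => /andP. Qed.

Lemma partition_le (sigma : nat -> R) q : (forall i, (i < q)%N -> sigma i < sigma i.+1) ->
  forall i j, (i <= j)%N -> (j <= q)%N -> sigma i <= sigma j.
Proof.
move=> inc i j ij; elim: j ij => [|j IH]; first by rewrite leqn0 => /eqP ->.
rewrite leq_eqVlt => /orP[/eqP -> //|ij] jq.
by apply: le_trans (IH ij (ltnW jq)) _; apply/ltW/inc.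
Qed.

(** The blocks are added one at a time; measurability and nonnegativity of [f] are carried along,
    because additivity of the integral asks for them. *)
Lemma step_integral (q : nat) (sigma : nat -> R) (f : R -> \bar R) (F : 'I_q -> R) :
  sigma 0%N = 0 -> sigma q = 1 -> (forall i, (i < q)%N -> sigma i < sigma i.+1) ->
  (forall c, 0 <= F c) -> (forall (c : 'I_q) t, block sigma c t -> f t = (F c)%:E) ->
  (\int[mu]_(t in (`[0%R, 1%R] : set R)) f t)%E = (\sum_c concentration q sigma c * F c)%:E.
Proof.
move=> s0 s1 inc F0 fE.
pose F' k := if insub k is Some c then F c else 0.
have F'E (c : 'I_q) : F' c = F c by rewrite /F' valK.
have H k : (k <= q)%N ->
    [/\ measurable_fun (`[0%R, sigma k[%classic : set R) f,
        forall t, (`[0%R, sigma k[%classic : set R) t -> (0 <= f t)%E &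
        (\int[mu]_(t in (`[0%R, sigma k[%classic : set R)) f t)%E =
        (\sum_(c < k) (sigma c.+1 - sigma c) * F' c)%:E].
  elim: k => [_|k IH kq].
    rewrite s0 big_ord0 set_itvco0 integral_set0; split=> //.
    exact: measurable_fun_set0.
  have [mf f0 intf] := IH (ltnW kq).
  pose c := Ordinal kq.
  have fc t : (`[sigma k, sigma k.+1[%classic : set R) t -> f t = (F c)%:E.
    by rewrite -block_itv; apply: (fE c).
  have split_itv : `[0%R, sigma k.+1[%classic = `[0%R, sigma k[%classic `|` `[sigma k, sigma k.+1[%classic :> set R.
    rewrite -itv_bndbnd_setU // bnd_simp; last exact/ltW/inc.
    by rewrite -s0 (partition_le inc) // ltnW.
  have mfc : measurable_fun (`[sigma k, sigma k.+1[%classic : set R) f.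
    apply: (eq_measurable_fun (cst (F c)%:E)) => //.
    by move=> t; rewrite inE => /fc ->.
  have mU : measurable_fun (`[0%R, sigma k[%classic `|` `[sigma k, sigma k.+1[%classic : set R) f.
    by apply/measurable_funU.
  have f0U t : (`[0%R, sigma k[%classic `|` `[sigma k, sigma k.+1[%classic : set R) t -> (0 <= f t)%E.
    by case=> [/f0//|/fc ->]; rewrite lee_fin.
  rewrite split_itv; split=> //.
  rewrite ge0_integral_setU //; last first.
    apply/disj_setPS => t /=; rewrite !in_itv /= => -[/andP[_ lt] /andP[ge _]].
    by have := lt_le_trans lt ge; rewrite ltxx.
  rewrite intf big_ord_recr EFinD /=; congr (_ + _)%E.
  rewrite (eq_integral (cst (F c)%:E)); last by move=> t; rewrite inE => /fc ->.
  rewrite integral_cst //= lebesgue_measure_itv /= lte_fin inc // -EFinB -EFinM.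
  by rewrite mulrC -(F'E c).
have [mf _ intf] := H q (leqnn q).
(* The endpoint 1 lies in no block, but a point has measure zero. *)
rewrite -integral_itv_bndo_bndc; last by rewrite -s1.
rewrite -[X in `[0%R, X[%classic]s1 intf; congr (_ %:E).
by apply: eq_bigr => c _; rewrite F'E.
Qed.

(** [c0] is the first block since the recursion of [iter_unif_int] ends at the constant coordinate
    0. *)
Lemma iter_unif_intE (q : nat) (sigma : nat -> R) (c0 : 'I_q) (k : nat)
    (f : (nat -> R) -> \bar R) (F : (nat -> 'I_q) -> R) :
  sigma 0%N = 0 -> sigma q = 1 -> (forall i, (i < q)%N -> sigma i < sigma i.+1) ->
  c0 = 0%N :> nat -> (forall b, 0 <= F b) ->
  (forall y (b : nat -> 'I_q), (forall i, block sigma (b i) (y i)) -> f y = (F b)%:E) ->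
  iter_unif_int k f = (disc_exp (concentration q sigma) c0 k F)%:E.
Proof.
move=> s0 s1 inc c00.
have conc0 c : 0 <= concentration q sigma c by rewrite subr_ge0 ltW // inc.
elim: k f F => [|k IH] f F F0 fF /=.
  by apply: fF => _; rewrite /block /= c00 s0; split=> //; rewrite -{1}s0 inc // -c00.
apply: step_integral => // [c|c t ct].
  have -> : 0 = disc_exp (concentration q sigma) c0 k (fun=> 0).
    by rewrite {IH}; elim: k => //= k <-; rewrite big1 // => d _; rewrite mulr0.
  exact: disc_exp_le.
apply: IH => [b|y b yb]; first exact: F0.
by apply: fF => i; case: ifP.
Qed.

End StepIntegral.

(** * Skeleton graphs and change of partition *)

Section Skeleton.
Variables (R : realType) (W : R -> R -> R).

Lemma block_left (q : nat) (sigma : nat -> R) (c : 'I_q) :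
  (forall i, (i < q)%N -> sigma i < sigma i.+1) -> block sigma c (sigma c).
Proof. by move=> inc; split=> //; apply: inc. Qed.

Lemma block_cover (q : nat) (sigma : nat -> R) t :
  sigma 0%N <= t -> t < sigma q -> exists c : 'I_q, block sigma c t.
Proof.
elim: q => [|q IH] t0 tq; first by have := le_lt_trans t0 tq; rewrite ltxx.
have [tq'|qt] := ltP t (sigma q).
  by have [c ct] := IH t0 tq'; exists (widen_ord (leqnSn q) c).
by exists ord_max.
Qed.

Lemma block_bounds (q : nat) (sigma : nat -> R) (c : 'I_q) t :
  is_partition W q sigma -> block sigma c t -> 0 <= t < 1.
Proof.
move=> [s0 [s1 [inc _]]] [ct tc]; rewrite -s0 -s1.
by rewrite (le_trans _ ct) ?(lt_le_trans tc) ?(partition_le inc) // ltnW.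
Qed.

Lemma skeletonP (q : nat) (sigma : nat -> R) (i j : 'I_q) x y :
  is_partition W q sigma -> block sigma i x -> block sigma j y ->
  skeleton W q sigma i j = (W x y != 0).
Proof.
move=> [_ [_ [_ cstW]]] ix jy; apply/asboolP/idP => [[x' [y' [ix' [jy' nz]]]]|nz].
  by rewrite (cstW i j x x' y y').
by exists x, y.
Qed.

Lemma skeleton_sym (q : nat) (sigma : nat -> R) :
  graphon W -> is_partition W q sigma -> symmetric (skeleton W q sigma).
Proof.
move=> [_ [_ symW]] part i j.
have [_ [_ [inc _]]] := part.
have bi := block_left i inc; have bj := block_left j inc.
have /andP[i0 i1] := block_bounds part bi; have /andP[j0 j1] := block_bounds part bj.
rewrite (skeletonP part bi bj) (skeletonP part bj bi) symW // in_itv /=.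
  by rewrite i0 ltW.
by rewrite j0 ltW.
Qed.

Lemma odd_cycle_edge (q : nat) (S : rel 'I_q) : has_odd_cycle S -> exists i j, S i j.
Proof. by case=> -[|c [|d p]] /and3P[_ _ //=] /andP[]; [exists c, c|exists c, d]. Qed.

Lemma connected_has_neighbour (q : nat) (S : rel 'I_q) k :
  graph_connected S -> (exists i j, S i j) -> exists l, S k l.
Proof.
move=> conS [i [j Sij]]; have /connectP[[|l p] /=] := conS k i.
  by move=> _ <-; exists j.
by move=> /andP[kl _] _; exists l.
Qed.

(* A path of blocks of one partition is followed by points of its blocks, which
   also walk through the blocks of the other one. *)
Lemma skeleton_connected_transfer (q0 q : nat) (sigma0 sigma : nat -> R) :
  is_partition W q0 sigma0 -> is_partition W q sigma ->
  graph_connected (skeleton W q0 sigma0) -> (exists i j, skeleton W q sigma i j) ->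
  graph_connected (skeleton W q sigma).
Proof.
move=> part0 part con0 [i1 [j1 S11]] i j.
have [a0 [a1 [inc0 _]]] := part0; have [s0 [s1 [inc _]]] := part.
have to0 (c : 'I_q) t : block sigma c t -> exists c' : 'I_q0, block sigma0 c' t.
  move=> ct; have /andP[t0 t1] := block_bounds part ct.
  by apply: block_cover; rewrite ?a0 ?a1.
have from0 (c : 'I_q0) t : block sigma0 c t -> exists c' : 'I_q, block sigma c' t.
  move=> ct; have /andP[t0 t1] := block_bounds part0 ct.
  by apply: block_cover; rewrite ?s0 ?s1.
have edge0 : exists u v, skeleton W q0 sigma0 u v.
  have bi := block_left i1 inc; have bj := block_left j1 inc.
  have [u ui] := to0 _ _ bi; have [v vj] := to0 _ _ bj.
  by exists u, v; rewrite (skeletonP part0 ui vj) -(skeletonP part bi bj).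
have bi := block_left i inc; have bj := block_left j inc.
have [k0 k0i] := to0 _ _ bi; have [k1 k1j] := to0 _ _ bj.
(* The walk starts at a neighbour of [k0]: every block of [sigma] meeting block [k] is adjacent to
   [i], whereas one meeting block [k0] need not be. *)
have [k S0k] := connected_has_neighbour k0 con0 edge0.
pose P (u : 'I_q0) := `[< forall t (i' : 'I_q), block sigma0 u t -> block sigma i' t ->
  connect (skeleton W q sigma) i i' >].
suff /asboolP Pk1 : P k1 by apply: Pk1 k1j bj.
apply: (connect_stable (P := P) _ (con0 k k1)) => [u v uv /asboolP Pu|]; apply/asboolP => t i' vt it.
  have bu := block_left u inc0; have [i'' ui''] := from0 _ _ bu.
  apply: connect_trans (Pu _ _ bu ui'') (connect1 _).
  by rewrite (skeletonP part ui'' it) -(skeletonP part0 bu vt).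
by apply: connect1; rewrite (skeletonP part bi it) -(skeletonP part0 k0i vt).
Qed.

End Skeleton.

(** * Convergence of the probability to 1 *)

(** Squaring y / 2 <= exp(y / 2) gives y^2 / 4 <= exp y, applied at y = a n. *)
Lemma exp_decay (R : realType) (a : R) (n : nat) : 0 < a -> (0 < n)%N ->
  n%:R * expR (- (a * n%:R)) <= 4 / a ^+ 2 / n%:R.
Proof.
move=> a0 n0; have nR : 0 < n%:R :> R by rewrite ltr0n.
have : (a * n%:R / 2) ^+ 2 <= expR (a * n%:R).
  have -> : expR (a * n%:R) = expR (a * n%:R / 2) ^+ 2 by rewrite -expRM_natl; congr expR; field.
  apply: lerXn2r; rewrite ?nnegrE ?expR_ge0 ?divr_ge0 ?mulr_ge0 ?(ltW a0) //.
  by apply: le_trans (expR_ge1Dx _); rewrite lerDr.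
rewrite expRN => le_exp; rewrite ler_pdivrMr ?expR_gt0 //.
rewrite -ler_pdivrMl ?divr_gt0 ?exprn_gt0 //.
apply: le_trans _ le_exp; rewrite le_eqVlt; apply/orP; left; apply/eqP; field.
by rewrite !gt_eqF.
Qed.

Section HamProbability.
Variables (R : realType) (W : R -> R -> R) (q : nat) (sigma : nat -> R).
Hypotheses (graphW : graphon W) (part : is_partition W q sigma).
Local Notation x := (concentration q sigma).

(** The conditional probability of a decomposition given the blocks of the nodes; left endpoints
    represent the blocks. *)
Definition grid_prob (n : nat) (b : nat -> 'I_q) : R :=
  \sum_(E : {set 'I_n * 'I_n} | E \subset upper_pairs n)
    edge_weight W (fun i => sigma (b i)) E * (`[< has_ham_decomposition (adjE E) >] : bool)%:R.

Lemma grid_in01 (i : 'I_q) : sigma i \in `[0, 1].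
Proof.
have [_ [_ [inc _]]] := part.
have /andP[i0 i1] := block_bounds part (block_left i inc).
by rewrite in_itv /= i0 ltW.
Qed.

Lemma grid_value_bounds (i j : 'I_q) : 0 <= W (sigma i) (sigma j) <= 1.
Proof. by have [_ [W01 _]] := graphW; apply: W01; apply: grid_in01. Qed.

Lemma grid_prob_ge0 n b : 0 <= grid_prob n b.
Proof.
apply: sumr_ge0 => E _; rewrite mulr_ge0 //; apply: prodr_ge0 => p _.
by have /andP[] := grid_value_bounds (b p.1) (b p.2); case: ifP => _; lra.
Qed.

Lemma grid_prob_le1 n b : grid_prob n b <= 1.
Proof.
have <- : \sum_(E : {set 'I_n * 'I_n} | E \subset upper_pairs n)
    edge_weight W (fun i => sigma (b i)) E = 1.
  have := edge_generating_function
    (fun p : 'I_n * 'I_n => W (sigma (b p.1)) (sigma (b p.2))) (fun=> 1).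
  rewrite [RHS]big1 => [|p _]; last by rewrite mulr1 addrC subrK.
  by move=> <-; apply: eq_bigr => E _; rewrite [X in _ * X]big1 ?mulr1 // => p _; case: ifP.
apply: ler_sum => E _; rewrite ler_piMr ?lern1 ?leq_b1 //.
apply: prodr_ge0 => p _.
by have /andP[] := grid_value_bounds (b p.1) (b p.2); case: ifP => _; lra.
Qed.

Lemma ham_probE (c0 : 'I_q) n : c0 = 0%N :> nat ->
  ham_prob W n = (disc_exp x c0 n (grid_prob n))%:E.
Proof.
move=> c00; have [s0 [s1 [inc cstW]]] := part.
apply: iter_unif_intE => // [b|y b yb]; first exact: grid_prob_ge0.
congr (_%:E); apply: eq_bigr => E _; congr (_ * _); apply: eq_bigr => p _.
by rewrite (cstW (b p.1) (b p.2) _ (sigma (b p.1)) _ (sigma (b p.2))) //; apply: block_left.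
Qed.

Lemma count_dev n (b : nat -> 'I_q) c :
  \sum_(i < n) ((b i == c)%:R - x c) = #|[set v : 'I_n | b v == c]|%:R - n%:R * x c.
Proof.
rewrite sumrB sumr_const card_ord -[x c *+ n]mulr_natl; congr (_ - _).
rewrite -sum1_card natr_sum [RHS]big_mkcond; apply: eq_bigr => i _.
by rewrite inE; case: (b i == c).
Qed.

End HamProbability.

Theorem mainTheorem1 (R : realType) (W : R -> R -> R) :
  step_graphon W ->
  (exists (q0 : nat) (sigma0 : nat -> R),
      is_partition W q0 sigma0 /\ graph_connected (skeleton W q0 sigma0)) ->
  forall (q : nat) (sigma : nat -> R),
    is_partition W q sigma ->
    has_odd_cycle (skeleton W q sigma) ->
    in_relint_edge_polytope (skeleton W q sigma) (concentration q sigma) ->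
    H_property W.
Proof.
move=> [graphW _] [q0 [sigma0 [part0 con0]]] q sigma part oddS xri.
set S := skeleton W q sigma in oddS xri.
set x := concentration q sigma in xri.
have [s0 [s1 [inc _]]] := part.
have edgeS := odd_cycle_edge oddS.
have conS : graph_connected S by apply: (skeleton_connected_transfer part0 part con0 edgeS).
have symS : symmetric S by apply: skeleton_sym.
have q_gt0 : (0 < q)%N by case: edgeS => i _; apply: leq_ltn_trans (ltn_ord i).
pose c0 := Ordinal q_gt0.
have qR : 0 < q%:R :> R by rewrite ltr0n.
have nbhdT : nbhd S [set: 'I_q]%SET = [set: 'I_q]%SET.
  have [//||_ //] := two_step_closed_full (A := [set: 'I_q]%SET) symS conS oddS.
    by apply/set0Pn; exists c0; rewrite finset.in_setT.
  exact: finset.subsetT.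
have [g g0 expand] := relint_expansion symS conS oddS xri.
have x_gt0 i : 0 < x i by rewrite subr_gt0 inc.
have x_ge0 i : 0 <= x i by apply/ltW.
have sum_x : \sum_i x i = 1.
  rewrite /x /concentration -(big_mkord xpredT (fun i => sigma i.+1 - sigma i)).
  by rewrite telescope_sumr // s1 s0 subr0.
have [|c c_gt0 cP] := @finite_positive_lower_bound R _ [pred ij : 'I_q * 'I_q | S ij.1 ij.2]
  (fun ij => W (sigma ij.1) (sigma ij.2)).
  move=> [i j] /= Sij; have /andP[W0 _] := grid_value_bounds graphW part i j.
  by rewrite lt0r W0 andbT -(skeletonP part (block_left i inc) (block_left j inc)).
have [xm xm_gt0 xmP] := @finite_positive_lower_bound R _ xpredT x (fun i _ => x_gt0 i).
(* With [delta] at most [kappa], each block has at least (xm - delta) n >= kappa n nodes. Since c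
   kappa / 4 = 2 eta, the degree term decays like exp(- eta n). *)
pose kappa := xm / 2; pose eta := c * kappa / 8.
have kappa0 : 0 < kappa by rewrite divr_gt0.
have eta0 : 0 < eta by rewrite divr_gt0 ?mulr_gt0.
pose delta := Num.min kappa (Num.min (g / (2 * q%:R)) (eta / q%:R)).
have delta0 : 0 < delta by rewrite !lt_min kappa0 !divr_gt0 ?mulr_gt0.
have deltak : delta <= kappa by rewrite ge_min lexx.
have deltag : 2 * q%:R * delta <= g.
  by rewrite mulrC -ler_pdivlMr ?mulr_gt0 // !ge_min lexx orbT.
have deltae : q%:R * delta <= eta.
  by rewrite mulrC -ler_pdivlMr // !ge_min lexx !orbT.
pose err (n : nat) := n%:R * expR (eta * n%:R - c * (kappa * n%:R - 1) / 4)
     + 4 ^+ n * expR (- (c * (delta * n%:R * (delta * n%:R - 1)) / 2)) : R.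
have err0 n : 0 <= err n.
  by rewrite addr_ge0 // mulr_ge0 ?expR_ge0 // exprn_ge0.
(* Either all block counts are within [delta * n%:R] of their means and [prob_ham_ge] applies, or
   one summand of the Chebyshev sum is at least 1. *)
have pointwise n (b : nat -> 'I_q) : 1 <= delta * n%:R ->
    1 <= grid_prob W sigma n b + (err n + \sum_i (delta * n%:R) ^- 2 *
      (\sum_(v < n) ((b v == i)%:R - x i)) ^+ 2).
  move=> dn; have dn0 : 0 < delta * n%:R by apply: lt_le_trans dn.
  have dn2 : 0 < (delta * n%:R) ^+ 2 by rewrite exprn_gt0.
  have sum0 (P : pred 'I_q) : 0 <= \sum_(i | P i) (delta * n%:R) ^- 2 *
      (\sum_(v < n) ((b v == i)%:R - x i)) ^+ 2.
    by apply: sumr_ge0 => i _; rewrite mulr_ge0 ?sqr_ge0 // invr_ge0 ltW.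
  case: (pselect (forall i, `|\sum_(v < n) ((b v == i)%:R - x i)| <= delta * n%:R)) => [small|].
    have countP i : `|#|[set v : 'I_n | b v == i]|%:R - n%:R * x i| <= delta * n%:R.
      by rewrite -count_dev small.
    rewrite -lerBlDl; apply: le_trans (_ : err n <= _); last by rewrite lerDl.
    apply: (prob_ham_ge (S := S) (x := x) (g := g) (b := fun v : 'I_n => b v)
      (H := fun u v : 'I_n => W (sigma (b u)) (sigma (b v)))) => //.
    - exact: ltW.
    - exact: ltW.
    - by move=> u v; apply: (grid_value_bounds graphW part).
    - move=> u v; have [_ [_ symW]] := graphW; exact: (symW _ _ (grid_in01 part _) (grid_in01 part _)).
    - by move=> u v Suv; apply: (cP (b u, b v)).
    - by move=> i; have := countP i; rewrite ler_norml => /andP[]; lra.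
    - move=> i; have := countP i; rewrite ler_norml => /andP[].
      have := xmP i isT; rewrite /kappa in deltak *; have : 0 <= n%:R :> R by []. nra.
  move=> /existsNP[i /negP]; rewrite -ltNge => big.
  rewrite ler_wpDl ?grid_prob_ge0 // ler_wpDl //.
  rewrite (bigD1 i) //= ler_wpDr //.
  rewrite mulrC ler_pdivlMr // mul1r -[leRHS]real_normK ?num_real //.
  by rewrite lerXn2r ?nnegrE ?normr_ge0 ?ltW.
pose u n := disc_exp x c0 n (grid_prob W sigma n).
have uE n : ham_prob W n = (u n)%:E by apply: ham_probE.
have u_le1 n : u n <= 1.
  rewrite -(disc_exp_cst c0 sum_x n 1); apply: disc_exp_le => // b.
  exact: grid_prob_le1.
have u_ge n : 1 <= delta * n%:R -> 1 <= u n + (err n + q%:R / delta ^+ 2 / n%:R).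
  move=> dn; have dn0 : 0 < delta * n%:R by apply: lt_le_trans dn.
  have n0 : 0 < n%:R :> R by rewrite -(pmulr_rgt0 _ delta0).
  have := disc_exp_le c0 x_ge0 n (fun b => pointwise n b dn).
  rewrite (disc_exp_cst _ sum_x) disc_expD disc_expD (disc_exp_cst _ sum_x) disc_exp_sum.
  move=> le1; apply: le_trans le1 _; rewrite !lerD2l.
  under eq_bigr do rewrite (disc_exp_sqr_dev _ sum_x).
  apply: le_trans (_ : \sum_(i < q) (delta ^+ 2)^-1 / n%:R <= _).
    apply: ler_sum => i _.
    have -> : (delta ^+ 2)^-1 / n%:R = (delta * n%:R) ^- 2 * n%:R by field; rewrite !gt_eqF.
    rewrite ler_wpM2l ?invr_ge0 ?exprn_ge0 ?(ltW dn0) // ler_piMr ?(ltW n0) //.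
    have := sqr_ge0 (2 * x i - 1); nra.
  by rewrite sumr_const card_ord -[_ *+ q]mulr_natl mulrA.
(* The summands come from low degrees, from large sets without an edge, and from Chebyshev's
   inequality. *)
pose K := expR (c / 4) * (4 / eta ^+ 2) + 1 + q%:R / delta ^+ 2.
have u_near : \forall n \near \oo%classic, 1 <= u n + K / n%:R.
  near=> n.
  have n_gt0 : (0 < n)%N by near: n; exact: nbhs_infty_gt.
  have nR : 0 < n%:R :> R by rewrite ltr0n.
  (* This makes the exponent c delta n (delta n - 1) / 2 at least 3 n; as 4^n <= exp(2 n), the
     second error term is at most exp(- n) <= 1 / n. *)
  have big : 6 / (c * delta) + 1 <= delta * n%:R.
    rewrite [leRHS]mulrC -ler_pdivrMr //; near: n; exact: nbhs_infty_ger.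
  have dn1 : 1 <= delta * n%:R.
    by apply: le_trans big; rewrite lerDr divr_ge0 ?mulr_ge0 // ltW.
  apply: le_trans (u_ge n dn1) _; rewrite lerD2l /K 2!mulrDl lerD2r mul1r /err; apply: lerD.
    have -> : eta * n%:R - c * (kappa * n%:R - 1) / 4 = c / 4 + - (eta * n%:R).
      by rewrite /eta; field.
    rewrite expRD mulrCA -mulrA ler_wpM2l ?expR_ge0 //; exact: exp_decay.
  apply: le_trans (_ : expR (2 * n%:R) * expR (- (3 * n%:R)) <= _).
    apply: ler_pM; rewrite ?exprn_ge0 ?expR_ge0 //.
      rewrite mulrC expRM_natl; apply: lerXn2r; rewrite ?nnegrE ?expR_ge0 //.
      have := @expR_ge1Dx R 1; have -> : 2 = 2%:R * 1 :> R by rewrite mulr1.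
      by rewrite expRM_natl; nra.
    rewrite ler_expR lerN2.
    have : 6 <= c * delta * (delta * n%:R - 1).
      by rewrite [leRHS]mulrC -ler_pdivrMr ?mulr_gt0 // lerBrDr.
    nra.
  rewrite -expRD (_ : _ + _ = - n%:R); last by ring.
  rewrite expRN lef_pV2 ?posrE ?expR_gt0 //.
  by apply: le_trans (expR_ge1Dx _); rewrite lerDr.
rewrite /H_property (_ : ham_prob W = EFin \o u); last by apply/funext => n; rewrite uE.
apply: cvg_EFin; first by near=> n.
apply/cvgrPdist_le => e e0; near=> n.
have n_gt0 : (0 < n)%N by near: n; exact: nbhs_infty_gt.
have nR : 0 < n%:R :> R by rewrite ltr0n.
rewrite ger0_norm ?subr_ge0 // lerBlDl.
have : 1 <= u n + K / n%:R by near: n.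
have : K / n%:R <= e.
  rewrite ler_pdivrMr // [leRHS]mulrC -ler_pdivrMr //; near: n; exact: nbhs_infty_ger.
rewrite /=; lra.
Unshelve. all: by end_near.
Qed.
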